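(* Let $N\ge 3$ and let $(A,B)$ be a pair of $N$-sunbursts, with $A$ regular and $B$ balanced. Then $(A,B)$ has a unique phase modification $(A,B')$ which supports adapted $N$-gons.
   Context: An $N$-sunburst is a collection of $N$ distinct rays emanating from the origin in $\mathbb{R}^2$ whose convex hull is the whole plane. In a pair $(A,B)$ of $N$-sunbursts the rays are labelled in counterclockwise cyclic order, those of $A$ by odd indices $A_1,A_3,\dots,A_{2N-1}$ and those of $B$ by even indices $B_2,B_4,\dots,B_{2N}$; indices are taken mod $2N$. The rays of $A$ are oriented outward (away from the origin) and the rays of $B$ are oriented inward (toward the origin). An $N$-sunburst is balanced if the sum of the $N$ outward unit vectors parallel to its rays is $0$. It is regular if its rays are parallel to the $N$th roots of unity. A pair $(A,B')$ is a phase modification of $(A,B)$ if $B'$ is obtained from $B$ by a rotation about the origin (the labels of the rays being carried along by the rotation); uniqueness refers to uniqueness of the resulting labelled sunburst $B'$. The pair $(A,B)$ supports adapted $N$-gons if there are counterclockwise-oriented convex $N$-gons, one with vertices $a_1,a_3,\dots,a_{2N-1}$, where $a_k$ is in the interior of $A_k$ (i.e. $a_k \in A_k\setminus\{0\}$), and one with vertices $b_2,b_4,\dots,b_{2N}$, where $b_k\in B_k\setminus\{0\}$, such that edges and rays with the same label are parallel in the oriented sense: for every even $k$ the vector $a_{k+1}-a_{k-1}$ is a positive multiple of the inward direction of $B_k$, and for every odd $k$ the vector $b_{k+1}-b_{k-1}$ is a positive multiple of the outward direction of $A_k$. *)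

(* Defs.v *)
From HB Require Import structures.
From mathcomp Require Import all_boot all_order all_algebra.
From mathcomp Require Import all_classical all_reals all_analysis.
From mathcomp.real_closed Require Import complex.

Set Implicit Arguments.
Unset Strict Implicit.
Unset Printing Implicit Defensive.

Import Order.TTheory GRing.Theory Num.Theory.

Local Open Scope classical_set_scope.
Local Open Scope complex_scope.
Local Open Scope ring_scope.

(* The plane R^2 is R[i]; a ray from the origin is encoded by its outward unit
   vector, and a labelled N-sunburst by a family u : 'I_N -> R[i] of such
   vectors.  The odd and even labels mod 2N of a pair (A, B) are encoded by
       A_{2j+1} = A j   and   B_{2j+2} = B j   (0 <= j < N),
   so that label arithmetic mod 2N is expressed with ordS and ord_pred, which
   are j |-> j + 1 and j |-> j - 1 mod N. *)

Section Sunburst.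
Variables (R : realType) (N : nat).
Implicit Types (u A B p : 'I_N -> R[i]) (v w : R[i]).

Definition cis (t : R) : R[i] := cos t +i* sin t.

(* Twice the signed area of the triangle 0, v, w. *)
Definition cross v w : R := complex.Re v * complex.Im w - complex.Im v * complex.Re w.

Definition ray v : set R[i] := [set z | exists t : R, 0 <= t /\ z = t%:C * v].

Definition pos_multiple w v := exists t : R, 0 < t /\ w = t%:C * v.

(* Rcomplex R is R[i] with its structure of vector space over R. *)
Definition convex_hull (X : set R[i]) : set R[i] :=
  [set z | forall C : set (Rcomplex R), @convex_set R (Rcomplex R) C -> X `<=` C -> C z].

Definition ccw_ordered u := exists theta : 'I_N -> R,
  [/\ forall j, u j = cis (theta j),
      forall i j : 'I_N, (i < j)%N -> theta i < theta j &
      forall i j, theta j < theta i + 2 * pi].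

Definition sunburst u :=
  [/\ forall j, `|u j| = 1,
      injective u,
      convex_hull (\bigcup_(j in [set: 'I_N]) ray (u j)) = setT &
      ccw_ordered u].

Definition balanced u := \sum_(j < N) u j = 0.

Definition regular u := range u = [set z | z ^+ N = 1].

Definition phase_modification B B' :=
  exists t : R, forall j, B' j = cis t * B j.

(* All other vertices lie strictly to the left of each oriented edge
   p j -> p (j + 1). *)
Definition ccw_convex_polygon p := forall i j : 'I_N,
  i != j -> i != ordS j -> 0 < cross (p (ordS j) - p j) (p i - p j).

(* The edge labelled 2j+2 joins a_{2j+1} = a j to a_{2j+3} = a (j + 1), and the
   edge labelled 2j+1 joins b_{2j} = b (j - 1) to b_{2j+2} = b j. *)
Definition supports_adapted A B := exists a b : 'I_N -> R[i],
  [/\ ccw_convex_polygon a /\ (forall j, (ray (A j) `\ 0) (a j)),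
      ccw_convex_polygon b /\ (forall j, (ray (B j) `\ 0) (b j)),
      forall j, pos_multiple (a (ordS j) - a j) (- B j) &
      forall j, pos_multiple (b j - b (ord_pred j)) (A j)].

End Sunburst.

(* Main.v *)
(* Write A_j = cis (alpha + h j) with h = 2 pi / N, B_j = cis theta_j with theta
   increasing, and d_j = alpha + h j - theta_j.  A closed polygon with vertices
   on the rays of A and edges parallel to those of B rotated by t exists exactly
   when, up to a common multiple of 2 pi, all x_j = d_j - t lie in (0, pi - h)
   and prod_j sin (x_j + h) = prod_j sin x_j: by the sine rule the factors
   sin x_j / sin (x_j + h) are the ratios of successive distances to the origin,
   and they must multiply to 1 around the cycle.  The polygon on B leads to the
   same condition.  Balance of B forces max d - min d < pi - h, because
   otherwise too many unit vectors would be crowded into a short arc.  Hence the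
   admissible t form a nonempty interval, on which prod sin (x_j + h) / sin x_j
   is strictly increasing in t, from below 1 to above 1. *)
Require Import Defs.
From mathcomp Require Import all_boot all_order all_algebra.
From mathcomp Require Import all_classical all_reals all_analysis.
From mathcomp.real_closed Require Import complex.
From mathcomp Require Import zify ring lra.

Set Implicit Arguments.
Unset Strict Implicit.
Unset Printing Implicit Defensive.

Import Order.TTheory GRing.Theory Num.Theory.
Import numFieldNormedType.Exports.

Local Open Scope complex_scope.
Local Open Scope ring_scope.

(** * Angles modulo full turns, sine inequalities and cross products *)

Section Trigonometry.
Variable R : realType.
Implicit Types (x y t a b h r s : R) (z v w : R[i]).

Lemma cisD x y : cis (x + y) = cis x * cis y.
Proof. by rewrite /cis cosD sinD; congr (_ +i* _); ring. Qed.

Lemma cis0 : cis (0 : R) = 1.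
Proof. by rewrite /cis cos0 sin0. Qed.

Lemma cisX x n : cis x ^+ n = cis (x *+ n).
Proof.
by elim: n => [|n IHn]; rewrite ?expr0 ?mulr0n ?cis0 // exprS mulrS cisD IHn.
Qed.

Lemma cisDpi x : cis (x + pi) = - cis x.
Proof. by rewrite /cis cosDpi sinDpi. Qed.

Lemma cis_period_nat x n : cis (x + 2 * pi * n%:R) = cis x.
Proof.
have -> : x + 2 * pi * n%:R = x + (pi *+ 2) *+ n by ring.
by rewrite /cis (periodicn (@cosD2pi R)) (periodicn (@sinD2pi R)).
Qed.

Lemma cis_period x (k : int) : cis (x + 2 * pi * k%:~R) = cis x.
Proof.
case: k => n; first exact: cis_period_nat.
rewrite NegzE -[RHS]/(cis x) -{2}[x](subrK (2 * pi * n.+1%:R)).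
by rewrite cis_period_nat; congr cis; rewrite mulrNz; ring.
Qed.

Lemma cis_neq0 x : cis x != 0.
Proof.
apply/eqP => x0; have : cis (x + - x) = 0 by rewrite cisD x0 mul0r.
by rewrite subrr cis0 => /eqP; rewrite oner_eq0.
Qed.

Lemma angle_reduction x : exists k : int, 0 <= x - 2 * pi * k%:~R < 2 * pi.
Proof.
have pi0 := pi_gt0 R; exists (Num.floor (x / (2 * pi))).
have /andP[] := floor_itv (x / (2 * pi)).
have p2 : 0 < 2 * pi :> R by lra.
rewrite ler_pdivlMr ?ltr_pdivrMr // intrD mulrDl mul1r => ? ?.
by apply/andP; split; lra.
Qed.

Lemma sin_period x (k : int) : sin (x - 2 * pi * k%:~R) = sin x.
Proof.
have -> : x - 2 * pi * k%:~R = x + 2 * pi * (- k)%:~R by rewrite mulrNz; ring.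
by case: (cis_period x (- k)).
Qed.

Lemma cos_period x (k : int) : cos (x - 2 * pi * k%:~R) = cos x.
Proof.
have -> : x - 2 * pi * k%:~R = x + 2 * pi * (- k)%:~R by rewrite mulrNz; ring.
by case: (cis_period x (- k)).
Qed.

Lemma sin_lt0_pi x : pi < x < 2 * pi -> sin x < 0.
Proof.
have pi0 := pi_gt0 R; move=> ?; rewrite -[x](subrK pi) sinDpi oppr_lt0.
by apply: sin_gt0_pi; lra.
Qed.

Lemma sin_le0_pi x : pi <= x <= 2 * pi -> sin x <= 0.
Proof.
have pi0 := pi_gt0 R; move=> ?; rewrite -[x](subrK pi) sinDpi oppr_le0.
by apply: sin_ge0_pi; lra.
Qed.

Lemma cos_eq1 x : cos x = 1 -> exists k : int, x = 2 * pi * k%:~R.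
Proof.
have pi0 := pi_gt0 R.
have cos_lt1 y : 0 < y < 2 * pi -> cos y != 1.
  move=> yP; have sy : 0 < sin (y / 2) by apply: sin_gt0_pi; lra.
  have -> : y = (y / 2) *+ 2 by field.
  by rewrite cos_mulr2n; apply/eqP; have := cos2Dsin2 (y / 2); nra.
have [k /andP[xk0 xk2]] := angle_reduction x.
rewrite -(cos_period x k) => /eqP c1; exists k.
apply/eqP; rewrite -subr_eq0; apply: contraTT c1 => x0.
by apply: cos_lt1; rewrite lt_neqAle eq_sym x0 xk0.
Qed.

Lemma cis_eq x y : cis x = cis y -> exists k : int, x = y + 2 * pi * k%:~R.
Proof.
case=> cxy sxy.
have [|k xyk] := @cos_eq1 (x - y).
  by rewrite cosB cxy sxy -!expr2 cos2Dsin2.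
by exists k; rewrite -xyk addrC subrK.
Qed.

Lemma sin_gt0_reduction x :
  0 < sin x -> exists k : int, 0 < x - 2 * pi * k%:~R < pi.
Proof.
have pi0 := pi_gt0 R; have [k xk] := angle_reduction x.
rewrite -(sin_period x k) => sx; exists k; apply/andP; split.
  rewrite lt_neqAle (andP xk).1 andbT; apply: contraL sx => /eqP<-.
  by rewrite sin0 ltxx.
by rewrite ltNge; apply: contraL sx => xp; rewrite -leNgt sin_le0_pi //; lra.
Qed.

(** The two sides differ by [sin h * sin (x - y)]. Where the sines are positive, this says that
    [sin (x + h) / sin x] strictly decreases in [x]; the form without division multiplies well over
    all rays. *)
Lemma sin_cross_lt x y h : 0 < h < pi -> 0 < x - y < pi ->
  sin (x + h) * sin y < sin (y + h) * sin x.
Proof.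
move=> hh hxy; have := mulr_gt0 (sin_gt0_pi hh) (sin_gt0_pi hxy).
rewrite -subr_gt0 => h0; rewrite -subr_gt0; move: h0.
suff -> : sin (y + h) * sin x - sin (x + h) * sin y = sin h * sin (x - y).
  by rewrite subr0.
by rewrite sinB !sinD; ring.
Qed.

(* If sin dipped below its chord, the mean value theorem would give it a
   slope below [2 / pi] before the dip and one above it after. *)
Lemma sin_ge_chord x : 0 <= x <= pi / 2 -> 2 / pi * x <= sin x.
Proof.
have pi0 := pi_gt0 R; move=> xP; rewrite leNgt; apply/negP => sx.
have p2 : 2 / pi * (pi / 2) = 1 :> R
  by rewrite mulrA divfK ?gt_eqF // divff ?pnatr_eq0.
have cont a b : {within `[a, b], continuous (@sin R)}%classic.
  by apply: continuous_subspaceT; exact: continuous_sin.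
have x0 : 0 < x.
  rewrite lt_neqAle (andP xP).1 andbT; apply: contraL sx => /eqP<-.
  by rewrite mulr0 sin0 ltxx.
have x1 : x < pi / 2.
  rewrite lt_neqAle (andP xP).2 andbT; apply: contraL sx => /eqP->.
  by rewrite sin_pihalf p2 ltxx.
have [c] := MVT x0 (fun y _ => is_derive_sin y) (cont 0 x).
rewrite in_itv /= => /andP[c0 c1] cE.
have [d] := MVT x1 (fun y _ => is_derive_sin y) (cont _ _).
rewrite in_itv /= => /andP[d0 d1] dE.
have : cos d < cos c.
  by rewrite ltr_cos ?in_itv /=; lra.
move: cE dE; rewrite sin0 sin_pihalf !subr0 => cE dE; apply/negP.
rewrite -leNgt; apply: (@le_trans _ _ (2 / pi)).
  by rewrite -(ler_pM2r x0) -cE ltW.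
have x2 : 0 < pi / 2 - x by rewrite subr_gt0.
by rewrite -(ler_pM2r x2) -dE mulrBr p2; lra.
Qed.

Lemma ReM_real r z : complex.Re (r%:C * z) = r * complex.Re z.
Proof. by case: z => a b /=; rewrite mul0r subr0. Qed.

Lemma ImM_real r z : complex.Im (r%:C * z) = r * complex.Im z.
Proof. by case: z => a b /=; rewrite mul0r addr0. Qed.

Lemma cross_cis r s x y :
  cross (r%:C * cis x) (s%:C * cis y) = r * s * sin (y - x).
Proof. by rewrite /cross !ReM_real !ImM_real /= sinB; ring. Qed.

Lemma crossBr v w z : cross v (w - z) = cross v w - cross v z.
Proof. by case: v w z => [? ?] [? ?] [? ?]; rewrite /cross /=; ring. Qed.

Lemma crossNr v w : cross v (- w) = - cross v w.
Proof. by case: v w => [? ?] [? ?]; rewrite /cross /=; ring. Qed.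

Lemma eq_ReIm z w :
  complex.Re z = complex.Re w -> complex.Im z = complex.Im w -> z = w.
Proof. by case: z w => [? ?] [? ?] /= -> ->. Qed.

End Trigonometry.

(** Bridges cyclic sequences indexed by [nat], on which induction is easy, and [ordS], which reduces
    mod [N]. *)
Lemma periodic_modn (T : Type) (N : nat) (f : nat -> T) :
  (forall n, f (n + N)%N = f n) -> forall n, f (n %% N)%N = f n.
Proof.
move=> fN n; rewrite {2}(divn_eq n N) addnC.
by elim: (n %/ N)%N => [|k IHk]; rewrite ?addn0 // mulSnr addnA fN.
Qed.

(** * Convexity of closed polygons whose edges make one full turn *)

Section ConvexPolygon.
Variables (R : realType) (N : nat).
Implicit Types (gam s : nat -> R) (p : nat -> R[i]).

(* The distance from a vertex to the line through a given edge changes along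
   each further edge by a multiple of the sine of the turning angle, so it
   first increases from 0 and then decreases back to 0. *)
Lemma turning_left_of_edge gam s p :
  (forall n, gam n < gam n.+1) ->
  (forall n, gam (n + N)%N = gam n + 2 * pi) ->
  (forall n, p (n + N)%N = p n) ->
  (forall n, 0 < s n) ->
  (forall n, p n.+1 - p n = (s n)%:C * cis (gam n)) ->
  forall i j, (j.+1 < i < j + N)%N -> 0 < cross (p j.+1 - p j) (p i - p j).
Proof.
move=> gam_lt gamN pN s0 pS i j /andP[ji ijN].
have pi0 := pi_gt0 R.
have gam_mono : {homo gam : m n / (m < n)%N >-> m < n}
  by exact: homo_ltn lt_trans _.
pose g k := cross (p j.+1 - p j) (p k - p j).
have gS k : g k.+1 = g k + s j * s k * sin (gam k - gam j).
  by rewrite -cross_cis -!pS /g !crossBr; ring.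
have g1 : g j.+1 = 0 by rewrite /g /cross; ring.
have gN : g (j + N)%N = 0 by rewrite /g pN subrr /cross /= !mulr0 subrr.
have g_up m : gam (j.+1 + m)%N - gam j < pi -> 0 < g (j.+2 + m)%N.
  elim: m => [|m IHm] gm.
    rewrite !addn0 gS g1 add0r !mulr_gt0 // sin_gt0_pi //.
    by rewrite addn0 in gm; rewrite gm subr_gt0 gam_lt.
  rewrite addnS -addSn in gm; rewrite addnS gS addr_gt0 //.
    by apply: IHm; apply: le_lt_trans gm; rewrite lerD2r ltW // addSn gam_lt.
  rewrite !mulr_gt0 // sin_gt0_pi // gm subr_gt0 gam_mono //=.
  by rewrite !addSn ltnS leqW ?leq_addr.
(* [g_up] works forward from edge [j]; this works backward from the return to [p j] at index
   [j + N], along edges that have turned by more than [pi]. *)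
have g_down m k : (k + m.+1 = j + N)%N -> pi < gam k - gam j -> 0 < g k.
  elim: m k => [|m IHm] k kN gk; have : s j * s k * sin (gam k - gam j) < 0.
  - rewrite pmulr_rlt0 ?mulr_gt0 // sin_lt0_pi // gk ltrBlDl -gamN.
    by rewrite gam_mono //; lia.
  - by have := gS k; rewrite -addn1 kN gN; lra.
  - rewrite pmulr_rlt0 ?mulr_gt0 // sin_lt0_pi // gk ltrBlDl -gamN.
    by rewrite gam_mono //; lia.
  - have := IHm k.+1; rewrite addSnnS kN => /(_ erefl); rewrite gS.
    by have := gam_lt k; lra.
have [m im] : exists m, i = (j.+2 + m)%N by exists (i - j.+2)%N; lia.
(* Either the edge ending at vertex [i] has turned by less than [pi] from edge [j], or the edge
   leaving it has turned by more. *)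
have [gm|gm] := ltP (gam (j.+1 + m)%N - gam j) pi; first by rewrite im;
  exact: g_up.
apply: (g_down (j + N - i).-1); first by lia.
by apply: le_lt_trans gm _; rewrite ltrD2r im addSn gam_lt.
Qed.

Lemma turning_ccw_convex gam s p :
  (1 < N)%N ->
  (forall n, gam n < gam n.+1) ->
  (forall n, gam (n + N)%N = gam n + 2 * pi) ->
  (forall n, p (n + N)%N = p n) ->
  (forall n, 0 < s n) ->
  (forall n, p n.+1 - p n = (s n)%:C * cis (gam n)) ->
  ccw_convex_polygon (fun j : 'I_N => p j).
Proof.
move=> N1 gam_lt gamN pN s0 pS i j ij ijS.
have left := turning_left_of_edge gam_lt gamN pN s0 pS.
rewrite /= (periodic_modn pN).
have := ltn_ord i; have := ltn_ord j => jN iN.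
have {}ij : i != j :> nat by [].
have {}ijS : i != (j.+1 %% N)%N :> nat by [].
have [ji|ji] := ltnP j i.
  apply: left; rewrite modn_small in ijS; lia.
(* A vertex listed before the edge is met again one cycle later. *)
rewrite -(pN i); apply: left.
have [jN1|jN1] := ltnP j.+1 N; first by lia.
have jNE : j.+1 = N by lia.
by move: ijS; rewrite jNE modnn; lia.
Qed.

End ConvexPolygon.

(** Each angle is an integer multiple [k j] of [2 * pi / N]. These [N] integers strictly increase
    and span less than [N], so they are consecutive. *)
Lemma regular_angles (R : realType) (N : nat) (A : 'I_N -> R[i]) :
  (0 < N)%N -> ccw_ordered A -> regular A ->
  exists alpha : R, forall j, A j = cis (alpha + 2 * pi / N%:R * j%:R).
Proof.
move=> N0 [theta [AE theta_lt theta_2pi]] regA.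
have pi0 := pi_gt0 R; have NR : 0 < N%:R :> R by rewrite ltr0n.
have /choice[k kP] j : exists k : int, theta j *+ N = 2 * pi * k%:~R.
  have AN : A j ^+ N = 1.
    by have : [set z | z ^+ N = 1]%classic (A j) by rewrite -regA; exists j.
  have [|k ->] := @cis_eq R (theta j *+ N) 0; last by exists k; rewrite add0r.
  by rewrite -cisX -AE AN cis0.
have k_lt (i j : 'I_N) : (i < j)%N -> k i < k j.
  move=> /theta_lt ij; rewrite -(ltr_int R) -(@ltr_pM2l _ (2 * pi));
    last by lra.
  by rewrite -!kP ltrMn2r N0.
have k_gap d : forall i j : 'I_N, j = (i + d)%N :> nat -> k i + d%:Z <= k j.
  elim: d => [|d IHd] i j jE.
    by rewrite addr0 (_ : i = j) //; apply: val_inj; rewrite /= jE addn0.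
  have dN : (i + d < N)%N by have := ltn_ord j; lia.
  have := IHd i (Ordinal dN) erefl; have := @k_lt (Ordinal dN) j; rewrite /=;
    lia.
pose i0 := Ordinal N0.
have maxN : (N.-1 < N)%N by lia.
have k_max : k (Ordinal maxN) < k i0 + N%:Z.
  rewrite -(ltr_int R) -(@ltr_pM2l _ (2 * pi)); last by lra.
  rewrite intrD (mulrDr (2 * pi)) -!kP -pmulrn.
  by rewrite mulr_natr -mulrnDl ltrMn2r N0 theta_2pi.
have kE j : k j = k i0 + j%:Z.
  have := k_gap j i0 j; have := k_gap (N.-1 - j)%N j (Ordinal maxN).
  by have := ltn_ord j; rewrite /=; lia.
exists (theta i0) => j; rewrite AE; congr cis.
apply: (@mulIf _ N%:R); first exact: lt0r_neq0.
rewrite mulrDl mulrAC divfK ?lt0r_neq0 // !mulr_natr !kP kE intrD (mulrDr (2 * pi)).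
by rewrite -pmulrn mulr_natr.
Qed.

Lemma card_ord_between (N a b : nat) :
  (b <= N)%N -> #|[set l : 'I_N | (a <= l < b)%N]| = (b - a)%N.
Proof.
move=> bN; rewrite -sum1_card -[RHS]muln1 -sum_nat_const_nat.
rewrite big_geq_mkord (big_ord_widen_cond N _ (fun=> 1%N)) //.
by apply: eq_bigl => l; rewrite inE.
Qed.

(** * How many vectors of a balanced family can share a short arc *)

Section BalancedArcs.
Variables (R : realType) (N : nat) (u : 'I_N -> R).
Hypotheses (hN : (3 <= N)%N) (bal : \sum_j cis (u j) = 0).
Hypothesis cis_inj : injective (fun j => cis (u j)).

Lemma balanced_projection c : \sum_j cos (u j - c) = 0.
Proof.
have -> : \sum_j cos (u j - c) =
    complex.Re ((\sum_j cis (u j) : Rcomplex R) * cis (- c)).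
  rewrite mulr_suml (raddf_sum (@complex.Re R : Rcomplex R -> R)).
  by apply: eq_bigr => j _; rewrite -cisD.
by rewrite bal mul0r.
Qed.

(** Project the zero sum on direction [c] and let [m = #|S|]. The vectors of [S] contribute at least
    [m * sin (pi * m / N)], the others at least [-(N - m)]. For [m < N] the chord bound makes the
    total at least [(N - m) * (2 * m / N - 1)], which is positive. For [m = N] all projections are
    nonnegative, hence zero, which leaves two possible positions for three distinct vectors. *)
Lemma balanced_cap (S : {set 'I_N}) c :
  (N < 2 * #|S|)%N ->
  (forall l, l \in S -> sin (pi * #|S|%:R / N%:R) <= cos (u l - c)) -> False.
Proof.
set m := #|S| => mN Scos; have pi0 := pi_gt0 R.
have NR : 0 < N%:R :> R by rewrite ltr0n; lia.
have mleN : (m <= N)%N by rewrite -[X in (_ <= X)%N](card_ord N) max_card.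
have := balanced_projection c.
rewrite (bigID (mem S)) /=; set sS := \sum_(_ in _) _ => sum0.
have [mEN|mltN] := eqVneq m N.
  have ST : S = [set: 'I_N].
    by apply/eqP; rewrite eqEcard finset.subsetT cardsT card_ord -/m mEN leqnn.
  have cos_ge0 l : 0 <= cos (u l - c).
    by have := Scos l; rewrite ST inE mEN mulfK ?lt0r_neq0 // sinpi => /(_ isT).
  have cos0' l : cos (u l - c) = 0.
    have /eqP := balanced_projection c.
    by rewrite psumr_eq0 // => /allP/(_ l (mem_index_enum _))/eqP.
  have cis_eq l1 l2 : sin (u l1 - c) = sin (u l2 - c) -> l1 = l2.
    move=> s12; apply: cis_inj; rewrite /= -[u l1](subrK c) -[u l2](subrK c).
    by rewrite (cisD (u l1 - c)) (cisD (u l2 - c)) /cis s12 !cos0'.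
  have sin_pm l : sin (u l - c) = 1 \/ sin (u l - c) = -1.
    have := cos2Dsin2 (u l - c); rewrite cos0' expr0n add0r => /eqP.
    by rewrite sqrf_eq1 => /orP[] /eqP; [left | right].
  have h0 : (0 < N)%N by lia.
  have h1 : (1 < N)%N by lia.
  have := @cis_eq (Ordinal h0) (Ordinal h1).
  have := @cis_eq (Ordinal h0) (Ordinal hN).
  have := @cis_eq (Ordinal h1) (Ordinal hN).
  case: (sin_pm (Ordinal h0)) => ->; case: (sin_pm (Ordinal h1)) => ->;
    case: (sin_pm (Ordinal hN)) => -> e1 e2 e3;
    by first [case: (e1 erefl) | case: (e2 erefl) | case: (e3 erefl)].
have {mltN mleN} mltN : (m < N)%N by rewrite ltn_neqAle mltN.
have sS_ge : m%:R * sin (pi * m%:R / N%:R) <= sS.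
  rewrite mulr_natl -sumr_const; apply: ler_sum => l; exact: Scos.
have sC_ge : - (N - m)%:R <= \sum_(l | l \notin S) cos (u l - c).
  have -> : (N - m)%N = #|~: S| by have := cardsC S; rewrite card_ord -/m; lia.
  rewrite -mulNrn -sumr_const [leRHS](eq_bigl (fun l => l \in ~: S));
    last first.
    by move=> l; rewrite inE.
  by apply: ler_sum => l _; rewrite cos_geN1.
have chord : 2 * (N - m)%:R / N%:R <= sin (pi * m%:R / N%:R) :> R.
  (* Reflection moves the angle into [[0, pi / 2]], since [N < 2 * m]. *)
  have -> : sin (pi * m%:R / N%:R) = sin (pi * (N - m)%:R / N%:R) :> R.
    rewrite natrB 1?ltnW // mulrBr mulrBl mulfK ?lt0r_neq0 //.
    by rewrite sinB sinpi cospi; ring.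
  have -> : 2 * (N - m)%:R / N%:R = 2 / pi * (pi * (N - m)%:R / N%:R) :> R.
    by rewrite !mulrA divfK ?lt0r_neq0.
  apply: sin_ge_chord; rewrite divr_ge0 ?mulr_ge0 ?ler0n ?(ltW pi0) //=.
  rewrite ler_pdivrMr // -mulrA ler_pM2l //.
  have : 2 * (N - m)%:R <= N%:R :> R by rewrite -natrM ler_nat; lia.
  by lra.
have : m%:R * (2 * (N - m)%:R / N%:R) <= (N - m)%:R :> R.
  apply: le_trans (_ : m%:R * sin (pi * m%:R / N%:R) <= _).
    by rewrite ler_wpM2l ?ler0n.
  by lra.
rewrite mulrA ler_pdivrMr // mulrA mulrC ler_pM2l ?ltr0n ?subn_gt0 //.
by rewrite mulrC -natrM ler_nat leqNgt mN.
Qed.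

(** The half-width [w] is chosen so that [cos w = sin (pi * #|S| / N)], the threshold of
    [balanced_cap]; [0 < w] amounts to [N < 2 * #|S|]. *)
Lemma balanced_arc (S : {set 'I_N}) c (w := pi * #|S|%:R / N%:R - pi / 2) :
  0 < w ->
  (forall l, l \in S -> exists k : int, `|u l - 2 * pi * k%:~R - c| <= w) ->
  False.
Proof.
have pi0 := pi_gt0 R; have NR : 0 < N%:R :> R by rewrite ltr0n; lia.
move=> w0 Sw; apply: (@balanced_cap S c) => [|l /Sw[k lk]].
  move: w0; rewrite /w subr_gt0 ltr_pdivlMr // mulrAC -mulrA ltr_pM2l //.
  by rewrite ltr_pdivrMr // -natrM ltr_nat mulnC.
have -> : u l - c = u l - 2 * pi * k%:~R - c + 2 * pi * k%:~R by ring.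
rewrite -(cos_period _ k) addrK -cosBpihalf -/w -(cos_norm (_ - c)).
have wpi : w <= pi.
  have mN : #|S|%:R <= N%:R :> R
    by rewrite ler_nat -[X in (_ <= X)%N](card_ord N) max_card.
  suff : pi * #|S|%:R / N%:R <= pi :> R by rewrite /w; lra.
  by rewrite ler_pdivrMr // ler_pM2l.
rewrite leNgt ltr_cos -?leNgt // in_itv /= ?normr_ge0 ?(ltW w0) ?wpi //.
exact: le_trans wpi.
Qed.

End BalancedArcs.

(** * The phase at which the two sine products agree *)

Section Phase.
Variables (R : realType) (N : nat) (h : R).
Hypotheses (hN : (3 <= N)%N) (hE : h * N%:R = 2 * pi).

Lemma step_angle : 0 < h < pi.
Proof.
have pi0 := pi_gt0 R; have N3 : 3 <= N%:R :> R by rewrite ler_nat.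
have NR : 0 < N%:R :> R by lra.
rewrite -(ltr_pM2r NR 0) -(ltr_pM2r NR h) mul0r hE mulr_gt0 //= mulrC ltr_pM2l //; lra.
Qed.

(* If the gap were violated, the vectors from [j] to [i] would be crowded into
   an arc so short that their sum outweighs the remaining unit vectors. *)
Lemma balanced_spread (theta : 'I_N -> R) :
  (forall i j : 'I_N, (i < j)%N -> theta i < theta j) ->
  (forall i j, theta j < theta i + 2 * pi) ->
  \sum_j cis (theta j) = 0 -> injective (fun j => cis (theta j)) ->
  forall i j : 'I_N,
    (h * i%:R - theta i) - (h * j%:R - theta j) < pi - h.
Proof.
move=> theta_lt theta_2pi bal cis_inj i j.
have pi0 := pi_gt0 R; have NR : 0 < N%:R :> R by rewrite ltr0n; lia.
have piE m : pi * m%:R / N%:R = h * m%:R / 2 :> R.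
  apply: (@mulIf _ N%:R); first exact: lt0r_neq0.
  by rewrite divfK ?lt0r_neq0 // mulrAC (mulrAC h) hE; lra.
have theta_le (a b : 'I_N) : (a <= b)%N -> theta a <= theta b.
  rewrite leq_eqVlt => /orP[/eqP/val_inj->//|/theta_lt]; exact: ltW.
rewrite ltNge; apply/negP => gap.
have [ij|ij|ij] := ltngtP i j.
(* Here the arc from [j] to [i] wraps past index 0: it runs from [theta j] to [theta i + 2 * pi], so
   indices up to [i] are shifted by one turn ([k = -1]). The assumed gap says that its length is at
   most [2 * w]. *)
- pose S := ~: [set l : 'I_N | (i.+1 <= l < j)%N].
  have Scard : #|S| = (N - j + i.+1)%N.
    have := cardsC [set l : 'I_N | (i.+1 <= l < j)%N].
    rewrite card_ord_between ?card_ord; last exact: ltnW.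
    by have := ltn_ord j; rewrite -/S; move: #|S| => m; lia.
  have SR : h * #|S|%:R = 2 * pi - h * j%:R + h * i%:R + h.
    rewrite Scard natrD natrB; last exact: ltnW.
    by rewrite -natr1 -hE; ring.
  apply: (@balanced_arc _ _ _ hN bal cis_inj S ((theta i + 2 * pi + theta j) / 2)).
    by rewrite piE SR; have := theta_2pi i j; lra.
  move=> l; rewrite !inE negb_and -!leqNgt => /orP[li|jl].
    exists (-1); rewrite mulrN1 opprK piE SR ler_norml.
    by have := theta_2pi l j; have := theta_le _ _ li; lra.
  exists 0; rewrite mulr0 subr0 piE SR ler_norml.
  by have := theta_2pi i l; have := theta_le _ _ jl; lra.
- pose S := [set l : 'I_N | (j <= l < i.+1)%N].
  have Scard : #|S| = (i.+1 - j)%N by rewrite card_ord_between.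
  have SR : h * #|S|%:R = h * i%:R - h * j%:R + h.
    by rewrite Scard natrB 1?leqW 1?ltnW // -natr1; ring.
  apply: (@balanced_arc _ _ _ hN bal cis_inj S ((theta i + theta j) / 2)).
    by rewrite piE SR; have := theta_lt _ _ ij; lra.
  move=> l; rewrite !inE => /andP[jl li].
  exists 0; rewrite mulr0 subr0 piE SR ler_norml.
  by have := theta_le _ _ jl; have := theta_le _ _ li; lra.
- by move: gap step_angle; rewrite (val_inj ij) subrr; lra.
Qed.

Variable d : 'I_N -> R.
Hypothesis d_spread : forall i j, d i - d j < pi - h.

(** For [t < t'], [sin_cross_lt] applied factor by factor strictly separates two mixed products,
    which the two product equations make equal. *)
Lemma balancing_phase_unique t t' :
  (forall j, 0 < d j - t < pi - h) -> (forall j, 0 < d j - t' < pi - h) ->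
  \prod_j sin (d j - t + h) = \prod_j sin (d j - t) ->
  \prod_j sin (d j - t' + h) = \prod_j sin (d j - t') -> t = t'.
Proof.
wlog tt' : t t' / t < t' => [hwlog|] dt dt' tE t'E.
  have [tt'|tt'|//] := ltgtP t t'; first exact: hwlog.
  by apply/esym/hwlog.
have /andP[h0 hpi] := step_angle.
have : \prod_j (sin (d j - t + h) * sin (d j - t')) <
       \prod_j (sin (d j - t' + h) * sin (d j - t)).
  apply: ltr_prod => [|j _].
    by apply/hasP; exists (Ordinal hN) => //; rewrite mem_index_enum.
  have := dt j; have := dt' j => ? ?; rewrite mulr_ge0 ?ltW ?sin_gt0_pi //=;
    try lra.
  by apply: sin_cross_lt; lra.
by rewrite !big_split /= tE t'E mulrC ltxx.
Qed.

Lemma balancing_phase_exists : exists t,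
  (forall j, 0 < d j - t < pi - h) /\
  \prod_j sin (d j - t + h) = \prod_j sin (d j - t).
Proof.
have /andP[h0 hpi] := step_angle.
pose j0 := Ordinal hN.
have [jm _ jm_min] := arg_minP d (isT : predT j0).
have [jM _ jM_max] := arg_maxP d (isT : predT j0).
pose H t := \prod_j sin (d j - t + h) - \prod_j sin (d j - t).
have contH : continuous H.
  move=> t; apply: cvgB; apply: cvg_big => [|j _]; try exact: mul_continuous.
    apply: (@continuous_comp _ _ _ (fun t => d j - t + h) (@sin R));
      last exact: continuous_sin.
    by apply: cvgD; [apply: cvgB;
      [exact: cvg_cst | exact: cvg_id] | exact: cvg_cst].
  apply: (@continuous_comp _ _ _ (fun t => d j - t) (@sin R));
    last exact: continuous_sin.
  by apply: cvgB; [exact: cvg_cst | exact: cvg_id].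
(* At [a] the largest [d j - t] is [pi - h], so the first product of [H] vanishes; at [b] the
   smallest is 0, so the second one does. The remaining product is positive each time. *)
set a := d jM - (pi - h); set b := d jm.
have ab : a < b by have := d_spread jM jm; rewrite /a /b; lra.
have Ha : H a < 0.
  rewrite /H [X in X - _](bigD1 jM) //= (_ : d jM - a + h = pi) ?sinpi ?mul0r;
    last first.
    by rewrite /a; ring.
  rewrite sub0r oppr_lt0; apply: prodr_gt0 => j _; apply: sin_gt0_pi.
  by have := jm_min j isT; have := jM_max j isT; rewrite /= /a /b in ab *; lra.
have Hb : 0 < H b.
  rewrite /H [X in _ - X](bigD1 jm) //= (_ : d jm - b = 0) ?sin0 ?mul0r;
    last first.
    by rewrite /b; ring.
  rewrite subr0; apply: prodr_gt0 => j _; apply: sin_gt0_pi.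
  by have := jm_min j isT; have := jM_max j isT; rewrite /= /a /b in ab *; lra.
have [||t tab Ht] := @IVT R H a b 0 (ltW ab).
- exact: continuous_subspaceT.
- by rewrite ge_min le_max (ltW Ha) (ltW Hb) orbT.
(* Excluding the endpoints yields the strict bounds on [d j - t]. *)
have at' : a != t by apply: contraTneq Ha => ->; rewrite Ht ltxx.
have tb : t != b by apply: contraTneq Hb => <-; rewrite Ht ltxx.
have {tab} /andP[ta tb'] : a < t < b.
  by move: tab; rewrite in_itv /= !lt_neqAle at' tb.
exists t; split=> [j|]; last by apply/eqP; rewrite -subr_eq0; exact/eqP.
by have := jm_min j isT; have := jM_max j isT; rewrite /= /a /b in ta tb' *;
  lra.
Qed.

End Phase.

(** One full turn is added per completed cycle; the bound [theta j < theta i + 2 * pi] keeps the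
    lift increasing across the seam. *)
Lemma angle_lift (R : realType) (N : nat) (theta : 'I_N -> R) :
  (0 < N)%N ->
  (forall i j : 'I_N, (i < j)%N -> theta i < theta j) ->
  (forall i j, theta j < theta i + 2 * pi) ->
  exists beta : nat -> R,
    [/\ forall n, beta n < beta n.+1,
        forall n, beta (n + N)%N = beta n + 2 * pi &
        forall j : 'I_N, beta j = theta j].
Proof.
move=> N0 theta_lt theta_2pi.
pose md n : 'I_N := Ordinal (ltn_pmod n N0).
exists (fun n => theta (md n) + 2 * pi * (n %/ N)%:R); split=> [n|n|j].
- rewrite divnS //; have [dvd|ndvd] := boolP (N %| n.+1)%N.
    by rewrite natrD (mulrDr (2 * pi)) mulr1 addrA ltrD2r theta_2pi.
  by rewrite add0n ltrD2r theta_lt //= modnS (negPf ndvd).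
- rewrite divnDr // divnn N0 natrD (mulrDr (2 * pi)) mulr1 addrA.
  by congr (theta _ + _ + _); apply: val_inj; rewrite /= modnDr.
- rewrite divn_small // mulr0 addr0; congr theta.
  by apply: val_inj; rewrite /= modn_small.
Qed.

(** The linear relation among three plane vectors, with cross products as coefficients: a vector
    form of the sine rule. The factor [k] sets the scale. *)
Lemma cis_sum_collinear (R : realType) (k a b c : R) :
  (k * sin (b - c))%:C * cis a - (k * sin (a - c))%:C * cis b =
  (k * sin (b - a))%:C * cis c.
Proof.
by apply: eq_ReIm => /=; rewrite !sinB; ring.
Qed.

(** * Adapted polygons and the sine product equation *)

Section AdaptedPolygons.
Variables (R : realType) (N : nat) (h alpha : R).
Hypotheses (hN : (3 <= N)%N) (hE : h * N%:R = 2 * pi).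
Local Notation al n := (alpha + h * n%:R).

Let h_lt : 0 < h < pi.
Proof. exact: step_angle hN hE. Qed.

Let alS n : al n.+1 = al n + h.
Proof. by rewrite -natr1 mulrDr mulr1 addrA. Qed.

Let alN n : al (n + N)%N = al n + 2 * pi.
Proof. by rewrite natrD mulrDr hE addrA. Qed.

Lemma cis_ordS (j : 'I_N) : cis (al (ordS j)) = cis (al j + h).
Proof.
rewrite -alS; apply: (@periodic_modn _ N (fun n => cis (al n))) => n.
by rewrite alN -[2 * pi]mulr1 (cis_period_nat _ 1).
Qed.

(** Crossing an edge of [a] with the ray through either endpoint eliminates that endpoint, giving
    [s j * sin (x j) = r (j + 1) * sin h] and [s j * sin (x j + h) = r j * sin h]. Around the cycle
    the distances [r] have the same product on both sides. *)
Lemma adapted_sin (A B : 'I_N -> R[i]) (phi : 'I_N -> R)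
    (x := fun j : 'I_N => al j - phi j) :
  (forall j, A j = cis (al j)) -> (forall j, B j = cis (phi j)) ->
  supports_adapted A B ->
  [/\ forall j, 0 < sin (x j), forall j, 0 < sin (x j + h) &
      \prod_j sin (x j + h) = \prod_j sin (x j)].
Proof.
move=> AE BE [a [b [[_ a_ray] _ a_edge _]]].
have sh : 0 < sin h by exact: sin_gt0_pi.
have /choice[r rP] j : exists r : R, 0 < r /\ a j = r%:C * cis (al j).
  have [[r [r0 arE]] /= a0] := a_ray j; exists r; rewrite -AE; split=> //.
  rewrite lt_neqAle r0 andbT; apply: contra_notN a0 => /eqP r00.
  by rewrite arE -r00 mul0r.
have /choice[s sP] j : exists s : R,
    0 < s /\ a (ordS j) - a j = - (s%:C * cis (phi j)).
  by have [s [s0 sE]] := a_edge j; exists s; rewrite sE BE mulrN.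
have sin_x j : s j * sin (x j) = r (ordS j) * sin h.
  have : cross (1%:C * cis (al j)) (a (ordS j) - a j) =
         cross (1%:C * cis (al j)) (- (s j)%:C * cis (phi j)).
    by rewrite (sP j).2 mulNr.
  rewrite crossBr (rP _).2 cis_ordS (rP j).2 mulNr crossNr !cross_cis.
  rewrite subrr sin0 mulr0 subr0 !mul1r (addrC (al j)) addrK => ->.
  by rewrite -mulrN -sinN opprB.
have sin_xh j : s j * sin (x j + h) = r j * sin h.
  have : cross (1%:C * cis (al j + h)) (a (ordS j) - a j) =
         cross (1%:C * cis (al j + h)) (- (s j)%:C * cis (phi j)).
    by rewrite (sP j).2 mulNr.
  rewrite crossBr (rP _).2 cis_ordS (rP j).2 mulNr crossNr !cross_cis.
  rewrite subrr sin0 mulr0 sub0r !mul1r => /oppr_inj.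
  rewrite (_ : al j - (al j + h) = - h); last by ring.
  rewrite (_ : phi j - (al j + h) = - (x j + h)); last by rewrite /x; ring.
  by rewrite !sinN !mulrN => /oppr_inj.
split=> [j|j|].
- by rewrite -(pmulr_rgt0 _ (sP j).1) sin_x mulr_gt0 ?(rP _).1.
- by rewrite -(pmulr_rgt0 _ (sP j).1) sin_xh mulr_gt0 ?(rP _).1.
have s_neq0 : \prod_j s j != 0.
  by apply: lt0r_neq0; apply: prodr_gt0 => j _; have [] := sP j.
apply: (mulfI s_neq0); rewrite -!big_split /=.
rewrite (eq_bigr _ (fun j _ => sin_xh j)) (eq_bigr _ (fun j _ => sin_x j)).
by rewrite (reindex (@ordS N)) //; exact/onW_bij/ordS_bij.
Qed.

(** Both sines being positive puts each [x j] in [(0, pi - h)] modulo a turn. Different numbers of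
    turns would separate two of the [x j] by more than [pi + h], against the spread. *)
Lemma common_reduction (x : 'I_N -> R) :
  (forall i j, x i - x j < pi - h) ->
  (forall j, 0 < sin (x j)) -> (forall j, 0 < sin (x j + h)) ->
  exists k : int, forall j, 0 < x j - 2 * pi * k%:~R < pi - h.
Proof.
move=> x_spread sx sxh; have pi0 := pi_gt0 R; have /andP[h0 hpi] := h_lt.
have /choice[k kP] j : exists k : int, 0 < x j - 2 * pi * k%:~R < pi - h.
  have [k xk] := sin_gt0_reduction (sx j); exists k.
  have := sxh j; rewrite -(sin_period _ k) addrAC (andP xk).1 /= => sxk.
  by rewrite ltNge; apply: contraL sxk => ?; rewrite -leNgt sin_le0_pi //; lra.
have k_const i j : k i = k j.
  suff k_le a b : k a <= k b by apply/eqP; rewrite eq_le !k_le.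
  rewrite -ltzD1 -(ltr_int R) -(@ltr_pM2l _ (2 * pi)); last by lra.
  rewrite intrD (mulrDr (2 * pi)) mulr1.
  by have := kP a; have := kP b; have := x_spread a b; lra.
by exists (k (Ordinal hN)) => j; rewrite (k_const _ j).
Qed.

Lemma supports_adapted_of_phase (phi : nat -> R)
    (x := fun n => al n - phi n) :
  (forall n, phi n < phi n.+1) ->
  (forall n, phi (n + N)%N = phi n + 2 * pi) ->
  (forall n, 0 < x n < pi - h) ->
  \prod_(j < N) sin (x j + h) = \prod_(j < N) sin (x j) ->
  supports_adapted (fun j : 'I_N => cis (al j)) (fun j : 'I_N => cis (phi j)).
Proof.
move=> phi_lt phiN xP prodE; have pi0 := pi_gt0 R; have /andP[h0 hpi] := h_lt.
have sh : 0 < sin h by exact: sin_gt0_pi.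
have sx n : 0 < sin (x n) by apply: sin_gt0_pi; have := xP n; lra.
have sxh n : 0 < sin (x n + h) by apply: sin_gt0_pi; have := xP n; lra.
have xN n : x (n + N)%N = x n by rewrite /x alN phiN; ring.
(* Distances of the vertices of [a], with ratios dictated by the sine rule and [r 0 = 1]; the
   product equation makes [r] periodic, so the polygon closes. *)
pose r n : R := \prod_(k < n) (sin (x k) / sin (x k + h)).
have rS n : r n.+1 = r n * (sin (x n) / sin (x n + h)) by exact: big_ord_recr.
have r0 n : 0 < r n by apply: prodr_gt0 => k _; rewrite divr_gt0.
have rN n : r (n + N)%N = r n.
  elim: n => [|n IHn]; last by rewrite addSn !rS IHn xN.
  rewrite add0n /r big_ord0 prodf_div prodE divff //.
  by apply: lt0r_neq0; apply: prodr_gt0.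
(* Distances for [b]: then [q n.+1 / q n = sin (x n + h) / sin (x n.+1)], the ratio for which the
   edge of [b] from [n] is parallel to ray [n.+1] of [A]. *)
pose q n := (r n * sin (x n))^-1.
have q0 n : 0 < q n by rewrite invr_gt0 mulr_gt0.
have qN n : q (n + N)%N = q n by rewrite /q rN xN.
pose a n := (r n)%:C * cis (al n).
pose b n := (q n)%:C * cis (phi n).
have cisN (f : nat -> R) : (forall n, f (n + N)%N = f n + 2 * pi) ->
    forall n, cis (f (n + N)%N) = cis (f n).
  by move=> fN n; rewrite fN -[2 * pi]mulr1 (cis_period_nat _ 1).
have aN n : a (n + N)%N = a n by rewrite /a rN (cisN _ alN).
have bN n : b (n + N)%N = b n by rewrite /b qN (cisN _ phiN).
pose s n := r n * sin h / sin (x n + h).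
have s0 n : 0 < s n by rewrite divr_gt0 ?mulr_gt0.
(* The shift by [pi] reflects the inward orientation of [B]. *)
have aS n : a n.+1 - a n = (s n)%:C * cis (phi n + pi).
  have -> : (s n)%:C * cis (phi n + pi) =
      (r n / sin (x n + h) * sin (al n - al n.+1))%:C * cis (phi n).
    rewrite (_ : al n - al n.+1 = - h); last by rewrite alS; ring.
    by rewrite sinN cisDpi mulrN -mulNr -rmorphN /s mulrAC mulrN.
  rewrite -cis_sum_collinear -/(x n).
  rewrite (_ : al n.+1 - phi n = x n + h); last by rewrite /x alS; ring.
  by rewrite divfK ?lt0r_neq0 // -mulrA (mulrC _ (sin _)) -rS.
have bS n : exists t, 0 < t /\ b n.+1 - b n = t%:C * cis (al n.+1).
  (* The scale that turns the coefficients of [cis_sum_collinear] into [q n.+1] and [q n]. It is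
     negative, as is [sin (phi n - phi n.+1)], because [xE] puts [phi n.+1 - phi n] in [(0, pi)]. *)
  pose k := - (r n.+1 * sin (x n.+1) * sin (x n + h))^-1.
  have xE : phi n.+1 - phi n = x n + h - x n.+1 by rewrite /x alS; ring.
  have k0 : k < 0 by rewrite oppr_lt0 invr_gt0 !mulr_gt0.
  exists (k * sin (phi n - phi n.+1)); split.
    rewrite -opprB sinN mulrN -mulNr mulr_gt0 ?oppr_gt0 // sin_gt0_pi //.
    by have := phi_lt n; have := xP n; have := xP n.+1; lra.
  rewrite -cis_sum_collinear.
  rewrite (_ : phi n - al n.+1 = - (x n + h)); last by rewrite /x alS; ring.
  rewrite (_ : phi n.+1 - al n.+1 = - x n.+1); last by rewrite /x; ring.
  rewrite /b; congr (_%:C * _ - _%:C * _).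
    by rewrite sinN /q /k mulrNN [in RHS]invfM divfK ?lt0r_neq0.
  rewrite sinN /q /k mulrNN rS.
  have := lt0r_neq0 (sx n); have := lt0r_neq0 (sx n.+1).
  by have := lt0r_neq0 (sxh n); have := lt0r_neq0 (r0 n) => *; field;
    apply/and4P.
have /choice[sb sbP] := bS.
exists (fun j : 'I_N => a j), (fun j : 'I_N => b j).
have not0 c y : 0 < c -> c%:C * cis y != 0 :> R[i].
  by move=> c0; rewrite mulf_neq0 ?cis_neq0 // fmorph_eq0 lt0r_neq0.
have N1 : (1 < N)%N by exact: ltnW.
have alS_lt n : al n < al n.+1 by rewrite alS ltrDl.
split.
- split=> [|j].
    apply: (turning_ccw_convex N1 (gam := fun n
      => phi n + pi) _ _ aN s0 aS) => n.
      by rewrite ltrD2r.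
    by rewrite phiN addrAC.
  split; first by exists (r j); split=> //; exact: ltW.
  exact/eqP/not0.
- split=> [|j].
    apply: (turning_ccw_convex N1 (gam := fun n => al n.+1) _ _ bN
      (fun n => (sbP n).1) (fun n => (sbP n).2)) => n //.
    by rewrite -addSn alN.
  split; first by exists (q j); split=> //; exact: ltW.
  exact/eqP/not0.
- move=> j; exists (s j); split=> //.
  by rewrite /= (periodic_modn aN) aS cisDpi.
(* With [j = ordS k], the edge ending at [j] becomes the edge leaving [k]. *)
- move=> j; have := ord_predK j; move: (ord_pred j) => k <-.
  exists (sb k); split; first by have [] := sbP k.
  by rewrite cis_ordS -alS /= (periodic_modn bN) (sbP k).2.
Qed.

End AdaptedPolygons.

(** * Existence and uniqueness of the phase modification *)

Theorem theorem1p1 (R : realType) (N : nat) (hN : (3 <= N)%N)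
    (A B : 'I_N -> R[i]) (hA : sunburst A) (hB : sunburst B)
    (hreg : regular A) (hbal : balanced B) :
  exists! B' : 'I_N -> R[i],
    phase_modification B B' /\ supports_adapted A B'.
Proof.
have N0 : (0 < N)%N by exact: leq_trans hN.
have [_ _ _ A_ccw] := hA;
  have [_ B_inj _ [theta [BE theta_lt theta_2pi]]] := hB.
have [alpha] := regular_angles N0 A_ccw hreg.
set h := 2 * pi / N%:R => AE.
have hE : h * N%:R = 2 * pi by rewrite divfK // pnatr_eq0 -lt0n.
have cis_theta_inj : injective (fun j => cis (theta j)).
  by move=> i j ij; apply: B_inj; rewrite !BE.
have bal : \sum_j cis (theta j) = 0.
  by rewrite -[RHS]hbal; apply: eq_bigr => j _; rewrite BE.
clearbody h.
pose d (j : 'I_N) := alpha + h * j%:R - theta j.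
have d_spread i j : d i - d j < pi - h.
  have := balanced_spread hN hE theta_lt theta_2pi bal cis_theta_inj i j.
  by rewrite /d; lra.
have rotE t j : cis t * B j = cis (theta j + t).
  by rewrite BE addrC cisD.
have [t [dt tE]] := balancing_phase_exists hN hE d_spread.
exists (fun j => cis t * B j); split.
  split; first by exists t.
  have [beta [beta_lt betaN betaE]] := angle_lift N0 theta_lt theta_2pi.
  rewrite (_ : A = fun j => cis (alpha + h * j%:R)); last exact/funext.
  rewrite (_ : (fun j => cis t * B j) = fun j : 'I_N => cis (beta j + t));
    last first.
    by apply/funext => j; rewrite rotE betaE.
  have dE (j : 'I_N) : alpha + h * j%:R - (beta j + t) = d j - t.
    by rewrite /d betaE; ring.
  apply: (supports_adapted_of_phase hN hE (phi := fun n => beta n + t))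
    => [n|n|n|].
  - by rewrite ltrD2r.
  - by rewrite betaN addrAC.
  - rewrite -(@periodic_modn _ N (fun n => alpha + h * n%:R - (beta n + t))).
      by rewrite (dE (Ordinal (ltn_pmod n N0))).
    by move=> m; rewrite betaN natrD mulrDr hE; ring.
  - under eq_bigr do rewrite dE.
    by under [RHS]eq_bigr do rewrite dE.
move=> B' [[t' B'E]] adapted.
have B'phi j : B' j = cis (theta j + t') by rewrite B'E rotE.
have [sx sxh prodE] := adapted_sin hN hE AE B'phi adapted.
have dE (j : 'I_N) : alpha + h * j%:R - (theta j + t') = d j - t'
  by rewrite /d; ring.
(* Adaptedness constrains [t'] only through sines, so [t'] must be shifted by a common number of
   turns before it can be compared with [t]. *)
have [i j|j|j|k kP] := @common_reduction _ _ _ hN hE (fun j => d j - t').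
- by have := d_spread i j; lra.
- by rewrite -dE.
- by rewrite -dE.
have dkE (j : 'I_N) : d j - (t' + 2 * pi * k%:~R) = d j - t' - 2 * pi * k%:~R by ring.
have -> : t = t' + 2 * pi * k%:~R.
  apply: (balancing_phase_unique hN hE dt _ tE) => [j|]; first by rewrite dkE.
  under eq_bigr do rewrite dkE addrAC sin_period -dE.
  by under [RHS]eq_bigr do rewrite dkE sin_period -dE.
(* Angles that differ by whole turns give the same rotation of [B]. *)
by apply/funext => j; rewrite cis_period B'E.
Qed.
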